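(* For every integer $k\ge 1$ there exists a constant $C(k)$, depending only on $k$, such that the following holds for every integer $n\ge k$. Suppose that $I$ is an independent set in $J_{\pm}(n,k,0)$ and that no place intersects all the vertices of $I$, i.e. there is no coordinate $u\in\{1,\dots,n\}$ such that $v_u\neq 0$ for every $v\in I$. Then \[ |I| \le C(k)\binom{n}{k-2}. \]
   Context: For integers $n\ge k\ge 1$ and $t$, $J_{\pm}(n,k,t)$ denotes the graph whose vertex set consists of all vectors in $\{-1,0,1\}^n$ with exactly $k$ nonzero coordinates, two vertices being joined by an edge if and only if their scalar product (standard inner product in $\mathbb{R}^n$) equals $t$. An independent set is a set of vertices no two of which are joined by an edge. A place is a coordinate $u\in\{1,\dots,n\}$ (regarded as the pair $\{u^+,u^-\}$ of its two possible signs); it intersects a vertex $v$ if $v_u\ne 0$. Convention: $\binom{n}{m}=0$ for $m<0$. *)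

(* Defs.v *)
From mathcomp Require Import all_boot all_order all_algebra.

Set Implicit Arguments.
Unset Strict Implicit.
Unset Printing Implicit Defensive.

Import GRing.Theory.
Local Open Scope ring_scope.

Notation trit := (seq_sub [:: -1; 0; 1 : int]).

Definition nnz (n : nat) (v : 'rV[trit]_n) : nat :=
  #|[set i : 'I_n | ssval (v 0 i) != 0]|.

(* The vertices of J_{+-}(n, k, t); they do not depend on t. *)
Definition Jvertex (n k : nat) : finType := {v : 'rV[trit]_n | nnz v == k}.

Definition Jcoord (n k : nat) (v : Jvertex n k) (i : 'I_n) : int :=
  ssval (val v 0 i).

Definition Jdot (n k : nat) (v w : Jvertex n k) : int :=
  \sum_(i < n) Jcoord v i * Jcoord w i.

(* Edges join distinct vertices: without v != w there would be a loop at every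
   vertex when t = k. *)
Definition Jadj (n k : nat) (t : int) : rel (Jvertex n k) :=
  fun v w => (v != w) && (Jdot v w == t).

Definition independent (T : finType) (e : rel T) (I : {set T}) : Prop :=
  forall v w, v \in I -> w \in I -> ~~ e v w.

(* A place is identified with the coordinate carrying it. *)
Definition place_meets (n k : nat) (u : 'I_n) (v : Jvertex n k) : bool :=
  Jcoord v u != 0.

(* Binomial coefficient with an integer lower index, zero when it is negative.
   With m = k - 2 and k = 1 this gives 0, whereas truncated subtraction on nat
   would give 'C(n, 0) = 1. *)
Definition binz (n : nat) (m : int) : nat :=
  if m is Posz m' then 'C(n, m') else 0%N.

(* Main.v *)
(** The supports of the vertices of an independent set pairwise meet.  Fix one
    support A and, for every place u, a support B_u avoiding u.  A support S
    meets A in some u, and meets B_u in some w <> u, so S is one of the k-sets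
    through one of at most k * k pairs {u, w}; there are at most 'C(n, k - 2)
    of them for each pair.  A support carries at most 2 ^ k vertices. *)

Require Import Defs.
From mathcomp Require Import all_boot all_order all_algebra.

Set Implicit Arguments.
Unset Strict Implicit.
Unset Printing Implicit Defensive.

Import GRing.Theory.

(** Deleting [u] and [w] maps these sets injectively to sets of size [k - 2], since both points can
    be put back. *)
Lemma card_draws_pair (T : finType) (k : nat) (u w : T) : u != w ->
  #|[set S : {set T} | [&& #|S| == k, u \in S & w \in S]]|
    <= binz #|T| (k%:Z - 2)%R.
Proof.
move=> neq_uw; set F := [set S : {set T} | _].
have cardF S : S \in F -> [/\ #|S| = k, u \in S & w \in S :\ u].
  by rewrite !inE (eq_sym w) neq_uw => /and3P[/eqP].
case: (leqP 2 k) => [k_ge2 | k_lt2]; last first.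
  (* Two distinct points do not fit into a set of fewer than two elements, so here the family is
     empty. *)
  rewrite (_ : F = set0) ?cards0 //; apply/setP => S; rewrite in_set0.
  apply/negP => /cardF[Sk Su Sw]; move: k_lt2.
  by rewrite -Sk (cardsD1 u) Su (cardsD1 w) Sw.
rewrite subzn //= -card_draws.
rewrite -(card_in_imset (f := fun S => S :\ u :\ w) (D := F)).
  apply/subset_leq_card/subsetP => _ /imsetP[S /cardF[Sk Su Sw] ->].
  rewrite inE -Sk (cardsD1 u S) Su (cardsD1 w (S :\ u)) Sw.
  by rewrite !add1n subSS subSS subn0.
move=> S S' /cardF[_ Su Sw] /cardF[_ S'u S'w] eqS.
by rewrite -(setD1K Su) -(setD1K Sw) eqS (setD1K S'w) (setD1K S'u).
Qed.

Lemma leq_card_bigcup (I T : finType) (D : {set I}) (H : I -> {set T}) m :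
  {in D, forall i, #|H i| <= m} -> #|\bigcup_(i in D) H i| <= #|D| * m.
Proof.
move=> Hm; rewrite -sum_nat_const.
elim/big_rec2: _ => [|i m' H' Di le_m']; first by rewrite cards0.
by apply: leq_trans (leq_card_setU _ _) (leq_add (Hm i Di) le_m').
Qed.

Lemma card_nontrivial_intersecting (T : finType) (k : nat)
    (F : {set {set T}}) :
    {in F, forall A : {set T}, #|A| = k} ->
    {in F &, forall A B : {set T}, A :&: B != set0} ->
    (forall u, exists2 B, B \in F & u \notin B) ->
  #|F| <= k * k * binz #|T| (k%:Z - 2)%R.
Proof.
move=> Fk Fint Fnontriv; case: (set_0Vmem F) => [-> | [A FA]].
  by rewrite cards0.
have exB u : exists B, (B \in F) && (u \notin B).
  by have [B FB uB] := Fnontriv u; exists B; rewrite FB.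
pose B u := xchoose (exB u).
have FB u : B u \in F by have /andP[] := xchooseP (exB u).
have uB u : u \notin B u by have /andP[] := xchooseP (exB u).
pose G u w := [set S : {set T} | [&& #|S| == k, u \in S & w \in S]].
have subFG : F \subset \bigcup_(u in A) \bigcup_(w in B u) G u w.
  apply/subsetP => S FS.
  have /set0Pn[u /setIP[Su Au]] := Fint S A FS FA.
  have /set0Pn[w /setIP[Sw Bw]] := Fint S (B u) FS (FB u).
  apply/bigcupP; exists u => //; apply/bigcupP; exists w => //.
  by rewrite inE Fk ?eqxx ?Su.
apply: leq_trans (subset_leq_card subFG) _.
(* One factor [k] is the size of [A] and counts the choices of [u]; the other is the size of [B u]
   and counts those of [w]. *)
rewrite -mulnA -{1}(Fk A FA); apply: leq_card_bigcup => u _.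
rewrite -{1}(Fk _ (FB u)); apply: leq_card_bigcup => w Bw.
by apply: card_draws_pair; apply: contraNneq (uB u) => {1}->.
Qed.

Definition support (n k : nat) (v : Jvertex n k) : {set 'I_n} :=
  [set i | Jcoord v i != 0%R].

Lemma card_support (n k : nat) (v : Jvertex n k) : #|support v| = k.
Proof. exact/eqP/(valP v). Qed.

(** Once its support is fixed, a vertex is determined by the set of its coordinates equal to 1, a
    subset of [S]. *)
Lemma card_support_fiber (n k : nat) (S : {set 'I_n}) :
  #|[set v : Jvertex n k | support v == S]| <= 2 ^ #|S|.
Proof.
pose pos (v : Jvertex n k) := [set i | Jcoord v i == 1%R].
rewrite -card_powerset -(card_in_imset (f := pos)).
  apply/subset_leq_card/subsetP => _ /imsetP[v /[!inE] /eqP <- ->].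
  by apply/subsetP => i /[!inE] /eqP ->.
move=> v w /[!inE] /eqP <- /eqP/setP supp_wv /setP pos_vw.
apply/val_inj/rowP => i; apply: val_inj.
move/(_ i): supp_wv; move/(_ i): pos_vw; rewrite !inE /Jcoord /=.
(* Each of the two entries is -1, 0 or 1; in the six cases where they differ, the supports or the
   positive parts disagree at [i]. *)
have := valP (val v 0%R i); have := valP (val w 0%R i); rewrite /= !inE.
by move=> /or3P[]/eqP -> /or3P[]/eqP ->.
Qed.

Lemma card_le_support (n k : nat) (I : {set Jvertex n k}) :
  #|I| <= 2 ^ k * #|[set support v | v in I]|.
Proof.
rewrite -sum1_card (partition_big_imset (@support n k)) /= mulnC -sum_nat_const.
apply: leq_sum => _ /imsetP[v Iv ->]; rewrite sum1_card.
rewrite -[in 2 ^ k](card_support v); apply: leq_trans (card_support_fiber k _).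
by apply/subset_leq_card/subsetP => w; rewrite !inE => /andP[].
Qed.

(** Disjoint supports make every term of the scalar product vanish, so two distinct such vertices
    would be adjacent. *)
Lemma independent_support_meet (n k : nat) (I : {set Jvertex n k}) :
    0 < k -> independent (Jadj 0%R) I ->
  {in I &, forall v w, support v :&: support w != set0}.
Proof.
(* Independence says nothing about a vertex and itself; there the support is nonempty because [k] is
   positive. *)
move=> k_gt0 indI v w Iv Iw; have [<- | neq_vw] := eqVneq v w.
  by rewrite setIid -card_gt0 card_support.
apply/set0Pn/existsP; apply: contraNT (indI v w Iv Iw) => /existsPn disj.
rewrite /Jadj neq_vw /Jdot big1 // => i _; apply/eqP.
by rewrite mulf_eq0 -[_ || _]negbK negb_or; have := disj i; rewrite !inE.
Qed.

Theorem corollary1 (k : nat) (hk : (1 <= k)%N) :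
  exists C : nat,
    forall (n : nat) (hn : (k <= n)%N) (I : {set Jvertex n k}),
      independent (Jadj 0%R) I ->
      ~ (exists u : 'I_n, forall v, v \in I -> place_meets u v) ->
      (#|I| <= C * binz n (k%:Z - 2)%R)%N.
Proof.
(* The factor [2 ^ k] bounds the sign patterns on one support, and [k * k] the pairs of places that
   cover all supports. *)
exists (2 ^ k * (k * k)) => n _ I indI no_place.
apply: leq_trans (card_le_support I) _.
rewrite -mulnA leq_mul2l -[X in binz X _](card_ord n); apply/orP; right.
apply: card_nontrivial_intersecting.
- by move=> _ /imsetP[v _ ->]; apply: card_support.
- move=> _ _ /imsetP[v Iv ->] /imsetP[w Iw ->].
  exact: independent_support_meet hk indI v w Iv Iw.
move=> u; have [/forall_inP meet_u | /forall_inPn[v Iv v_u]] :=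
  boolP [forall v in I, place_meets u v]; first by case: no_place; exists u.
by exists (support v); rewrite ?imset_f // inE.
Qed.
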